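(* For all probability measures $P,Q$ and $\omega\in(0,1)$, with relative entropies in nats: (i) $\mathcal{I}_\omega(P\|Q)\le \omega-\frac12+\sqrt{\frac14-\frac{\omega(1-\omega)}{1+\omega\chi^2(P\|Q)}}$ for $\omega\in(0,\frac12]$, and $\mathcal{I}_\omega(P\|Q)\le\frac12-\omega+\sqrt{\frac14-\frac{\omega(1-\omega)}{1+\omega\chi^2(Q\|P)}}$ for $\omega\in(\frac12,1)$; (ii) $\mathcal{I}_\omega(P\|Q)\le\omega\,c_{(1-\omega)/\omega}\,D(P\|Q)$ for $\omega\in(0,\frac12)$; $\mathcal{I}_{1/2}(P\|Q)\le\sqrt{\frac18\min\{D(P\|Q),D(Q\|P)\}}$; and $\mathcal{I}_\omega(P\|Q)\le(1-\omega)\,c_{\omega/(1-\omega)}\,D(Q\|P)$ for $\omega\in(\frac12,1)$; (iii) $\mathcal{I}_\omega(P\|Q)\le\omega-\frac12+\sqrt{\frac14-\omega(1-\omega)e^{-D(P\|Q)}}$ for $\omega\in(0,\frac12]$, and $\mathcal{I}_\omega(P\|Q)\le\frac12-\omega+\sqrt{\frac14-\omega(1-\omega)e^{-D(Q\|P)}}$ for $\omega\in(\frac12,1)$.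
   Context: For densities $p,q$ w.r.t. a dominating measure $\mu$: DeGroot statistical information $\mathcal{I}_\omega(P\|Q):=\int q\,\phi_\omega(p/q)\,\mathrm{d}\mu$ with $\phi_\omega(t)=\min\{\omega,1-\omega\}-\min\{\omega t,1-\omega\}$ (standard $f$-divergence conventions at $0$); $\chi^2(P\|Q):=\int\frac{(p-q)^2}{q}\,\mathrm{d}\mu$; $D(P\|Q):=\int p\ln\frac pq\,\mathrm{d}\mu$ (nats). For $\gamma>1$: $t_\gamma:=-\gamma\,W_{-1}\bigl(-\frac1\gamma e^{-1/\gamma}\bigr)$, where $W_{-1}$ is the branch of the Lambert $W$ function on $[-1/e,0)$ with values in $(-\infty,-1]$, and $c_\gamma:=\frac{t_\gamma-\gamma}{t_\gamma\ln t_\gamma+1-t_\gamma}$. *)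

(* Defs.v *)
From HB Require Import structures.
From mathcomp Require Import all_boot all_order all_algebra.
From mathcomp Require Import all_classical all_reals all_analysis.
Set Implicit Arguments. Unset Strict Implicit. Unset Printing Implicit Defensive.
Import Order.TTheory GRing.Theory Num.Theory.
Local Open Scope classical_set_scope.
Local Open Scope ring_scope.

Section Defs.
Variable R : realType.

(* The branch W_{-1} of the Lambert W function on [-1/e, 0):
   the unique w <= -1 with w e^w = y (0 returned outside the domain). *)
Definition lambertWm1 (y : R) : R :=
  xget 0 [set w : R | w <= -1 /\ w * expR w = y].

Definition t_gam (g : R) : R := - g * lambertWm1 (- g^-1 * expR (- g^-1)).
Definition c_gam (g : R) : R :=
  (t_gam g - g) / (t_gam g * ln (t_gam g) + 1 - t_gam g).

Definition phi_deg (w t : R) : R := Num.min w (1 - w) - Num.min (w * t) (1 - w).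

Variables (d : measure_display) (T : measurableType d)
  (mu : {measure set T -> \bar R}).

(* DeGroot statistical information  I_w(P||Q) = \int q phi_w(p/q) dmu,
   with the standard f-divergence conventions at 0:
   0 * phi(0/0) = 0 and 0 * phi(a/0) = a * lim_{t->oo} phi(t)/t = 0. *)
Definition degroot_info (w : R) (p q : T -> R) : \bar R :=
  integral mu setT (fun x =>
    (if 0 < q x then q x * phi_deg w (p x / q x) else 0)%:E).

Definition chi2 (p q : T -> R) : \bar R :=
  integral mu setT (fun x =>
    if 0 < q x then ((p x - q x) ^+ 2 / q x)%:E
    else if 0 < p x then +oo%E else 0%E).

Definition KL (p q : T -> R) : \bar R :=
  integral mu setT (fun x =>
    if 0 < p x then (if 0 < q x then (p x * ln (p x / q x))%:E else +oo%E)
    else 0%E).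

End Defs.

Definition is_density (R : realType) (d : measure_display) (T : measurableType d)
  (mu : {measure set T -> \bar R}) (p : T -> R) : Prop :=
  [/\ measurable_fun setT p, (forall x, 0 <= p x) &
      integral mu setT (fun x => (p x)%:E) = 1%E].

(* Extended-real evaluation of a real-valued bound: [ext_bound f finf x]
   is f r when x = r%:E, and finf (the limiting value) when x = +oo
   (-oo never occurs for the divergences below). *)
Definition ext_bound (R : realType) (f : R -> R) (finf : \bar R) (x : \bar R) : \bar R :=
  match x with
  | EFin r => (f r)%:E
  | +oo%E => finf
  | -oo%E => finf
  end.

(* Main.v *)
Require Import Defs.
From HB Require Import structures.
From mathcomp Require Import all_boot all_order all_algebra.
From mathcomp Require Import all_classical all_reals all_analysis.
From mathcomp Require Import measurable_realfun ring lra.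
Import Order.TTheory GRing.Theory Num.Theory.
Import numFieldNormedType.Exports.
Local Open Scope classical_set_scope.
Local Open Scope ring_scope.

(* Write [e] for the integral of [min (w p) ((1 - w) q)], the Bayes error, so
   that [I_w(P||Q) = min w (1 - w) - e], and [m = w p + (1 - w) q].  Each bound
   is obtained by integrating a pointwise inequality whose left-hand side is an
   affine combination of [p], [q] and [min (w p) ((1 - w) q)] and whose
   right-hand side is the integrand of the divergence; its coefficients are
   tangent parameters chosen according to the values of the integrals, so no
   Cauchy-Schwarz or Jensen inequality is needed.  Parts (i) and (iii) both rest
   on [e (1 - e) >= w (1 - w) * \int p q / m]; the last integral is at least
   [1 / (1 + w chi2)] by convexity of [1 / y], and at least [exp (- D)] by
   convexity of [exp] and [D(P||M) >= 0].  Part (ii) uses the tangent line at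
   [t_gam] of [t ln t + 1 - t], and for [w = 1/2] Pinsker's inequality in the form
   [3 (t - 1)^2 <= (2 t + 4) (t ln t + 1 - t)].  The bounds for [w > 1/2] follow
   by exchanging [p] with [q] and [w] with [1 - w]. *)

(** * Elementary logarithm inequalities *)

Section real_inequalities.
Set Implicit Arguments. Unset Strict Implicit.
Context {R : realType}.
Implicit Types (w p q t a b c g : R).

Lemma ln_leB1 t : 0 < t -> ln t <= t - 1.
Proof. by move=> t0; rewrite -{1}(subrK 1 t) addrC le_ln1Dx// ltrBrDr addNr. Qed.

(** This is [ln x <= x - 1] at [x = b / a], scaled by [a]. Replacing [b] by [t * b] gives the
    tangent line at [a / b = t]. *)
Lemma mul_ln_ge a b : 0 < a -> 0 < b -> a - b <= a * ln (a / b).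
Proof.
move=> a0 b0; have ba0 : 0 < b / a by rewrite divr_gt0.
have -> : ln (a / b) = - ln (b / a) by rewrite -lnV ?posrE// invf_div.
rewrite mulrN lerNr opprB.
have /(ler_wpM2l (ltW a0)) := ln_leB1 ba0.
by rewrite mulrBr mulr1 mulrCA mulfV ?gt_eqF// mulr1.
Qed.

Lemma ln_div_chain a b c : 0 < a -> 0 < b -> 0 < c ->
  ln (a / c) = ln (a / b) + ln (b / c).
Proof. by move=> a0 b0 c0; rewrite !ln_div ?posrE// addrA subrK. Qed.

(** * The sharpened logarithm bound behind Pinsker's inequality *)

Lemma is_derive_inv_shift c t : t + c != 0 ->
  is_derive t 1 (fun x => (x + c)^-1) (- (t + c) ^- 2).
Proof.
move=> tc0; have := is_derive_shift t 1 c => -[d1 d2].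
apply: DeriveDef; first exact: derivableV.
by rewrite (deriveV (f := shift c))// d2 scaler1.
Qed.

(* [ln t - (t - 1) (5 t + 1) / (2 t (t + 2))] in partial fractions. *)
Definition pinsker_gap t :=
  ln t - 5 / 2 + 4^-1 * (t + 0)^-1 + 27 / 4 * (t + 2)^-1.

Lemma is_derive_pinsker_gap t : 0 < t ->
  is_derive t 1 pinsker_gap ((t - 1) ^+ 3 / (t * (t + 2)) ^+ 2).
Proof.
move=> t0.
have t1 : t + 0 != 0 by rewrite addr0 gt_eqF.
have t2 : t + 2 != 0 by rewrite gt_eqF// addr_gt0.
have := is_derive1_ln t0; have := is_derive_inv_shift t1.
have := is_derive_inv_shift t2 => d2 d1 dl.
rewrite /pinsker_gap.
have dl' := is_deriveB dl (is_derive_cst (5 / 2 : R) t 1).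
have D := is_deriveD (is_deriveD dl' (is_deriveZ 4^-1 d1)) (is_deriveZ (27 / 4) d2).
apply: (is_derive_eq D); rewrite /GRing.scale/= addr0 in t1 *.
by field; rewrite t1 t2.
Qed.

Lemma pinsker_gap1 : pinsker_gap 1 = 0.
Proof. by rewrite /pinsker_gap ln1; field. Qed.

(** The derivative has the sign of [t - 1], so the gap is minimal at [1], where it vanishes. *)
Lemma pinsker_gap_ge0 t : 0 < t -> 0 <= pinsker_gap t.
Proof.
move=> t0; rewrite -pinsker_gap1; have [t1|/ltW t1] := leP t 1.
- have pos x : x \in `]t, 1[ -> 0 < x.
    by rewrite in_itv/= => /andP[+ _]; exact: lt_trans.
  apply: (@ler0_derive1_nincr _ pinsker_gap t 1) => //.
  + by move=> x /pos /is_derive_pinsker_gap[].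
  + move=> x xt; rewrite derive1E; have [_ ->] := is_derive_pinsker_gap (pos _ xt).
    rewrite mulr_le0_ge0 ?invr_ge0 ?sqr_ge0//.
    move: xt; rewrite in_itv/= => /andP[_ /ltW x1].
    by rewrite exprS mulr_le0_ge0 ?sqr_ge0// subr_le0.
  + apply: derivable_within_continuous => x; rewrite in_itv/= => /andP[tx _].
    by have [] := is_derive_pinsker_gap (lt_le_trans t0 tx).
- have pos (x : R) : 1 <= x -> 0 < x by exact: lt_le_trans.
  apply: (@ger0_derive1_ndecr _ pinsker_gap 1 t) => //.
  + move=> x; rewrite in_itv/= => /andP[/ltW /pos x0 _].
    by case: (is_derive_pinsker_gap x0).
  + move=> x; rewrite in_itv/= => /andP[/ltW x1 _]; rewrite derive1E.
    have [_ ->] := is_derive_pinsker_gap (pos x x1).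
    by rewrite divr_ge0 ?sqr_ge0// exprn_ge0// subr_ge0.
  + apply: derivable_within_continuous => x; rewrite in_itv/= => /andP[/pos x0 _].
    by case: (is_derive_pinsker_gap x0).
Qed.

(** With [t = p / q], the difference of the two sides is exactly [p * pinsker_gap t]. *)
Lemma mul_ln_ge_sqr p q : 0 < p -> 0 < q ->
  p - q + 3 * (p - q) ^+ 2 / (2 * p + 4 * q) <= p * ln (p / q).
Proof.
move=> p0 q0; have := pinsker_gap_ge0 (divr_gt0 p0 q0).
rewrite /pinsker_gap addr0 => /(mulr_ge0 (ltW p0)) gap.
rewrite -subr_ge0; apply: le_trans gap _; rewrite le_eqVlt; apply/orP; left; apply/eqP.
set l := ln _.
by field; rewrite ?gt_eqF//; lra.
Qed.

(** * The tangent point [t_gam] and the Lambert function *)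

Lemma t_gam_exists g : 1 < g -> exists2 t, g <= t & g * ln t = t - 1.
Proof.
move=> g1; have g0 : 0 < g by exact: lt_trans g1.
pose f t := t - 1 - g * ln t.
(* The left end [g] avoids the trivial root [t = 1]. The right end is a square so that [ln (4 * g ^+
   2) = 2 * ln (2 * g) <= 2 * (2 * g - 1)] makes [f] nonnegative there. *)
have [|||t] := @IVT _ f g (4 * g ^+ 2) 0.
- by nra.
- apply/continuous_in_subspaceT => x; rewrite inE/= in_itv/= => /andP[gx _].
  have x0 := lt_le_trans g0 gx.
  apply: cvgB; first by apply: cvgB; [exact: cvg_id|exact: cvg_cst].
  by apply: cvgM; [exact: cvg_cst|exact: continuous_ln].
- have fg : f g <= 0.
    rewrite /f subr_le0; have := mul_ln_ge g0 ltr01.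
    by rewrite divr1.
  have f4 : 0 <= f (4 * g ^+ 2).
    rewrite /f; have -> : 4 * g ^+ 2 = (2 * g) * (2 * g) by ring.
    have g20 : 0 < 2 * g by lra.
    rewrite lnM ?posrE//; have /(ler_wpM2l (ltW g0)) := ln_leB1 g20.
    by nra.
  by rewrite ge_min fg/= le_max f4 orbT.
- rewrite in_itv/= => /andP[gt _] /eqP; rewrite subr_eq0 => /eqP ft.
  by exists t.
Qed.

Lemma t_gamP g : 1 < g -> g <= t_gam g /\ g * ln (t_gam g) = t_gam g - 1.
Proof.
move=> g1; have g0 : 0 < g by exact: lt_trans g1.
rewrite /t_gam; set y := - g^-1 * _.
have [W1 Wy] : [set w : R | w <= -1 /\ w * expR w = y] (lambertWm1 y).
  have [t gt gln] := t_gam_exists g1.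
  have t0 := lt_le_trans g0 gt.
  apply: (@xgetPex _ 0 [set w : R | w <= -1 /\ w * expR w = y]).
  (* For [w = - (t / g)], the branch condition [w <= -1] is [g <= t], and [g * ln t = t - 1] says
     [w = - g^-1 - ln t]. An element of the set thus exists, which rules out the default [0]. *)
  exists (- (t / g)) => /=; split.
    by rewrite lerN2 ler_pdivlMr// mul1r.
  have -> : - (t / g) = - g^-1 + - ln t.
    by apply: (mulfI (lt0r_neq0 g0)); rewrite mulrDr !mulrN gln; field; rewrite gt_eqF.
  rewrite expRD expRN lnK ?posrE// /y.
  have -> : - g^-1 + - ln t = - (t / g).
    by apply: (mulfI (lt0r_neq0 g0)); rewrite mulrDr !mulrN gln; field; rewrite gt_eqF.
  by field; rewrite !gt_eqF ?expR_gt0.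
set W := lambertWm1 y in W1 Wy *.
have NW0 : 0 < - W by lra.
split; first by nra.
(* Taking logarithms in the Lambert equation recovers [g * ln t = t - 1] for [t = - g * W]. *)
have : ln (- W * expR W) = ln (g^-1 * expR (- g^-1)) by rewrite mulNr Wy /y mulNr opprK.
rewrite lnM ?posrE ?expR_gt0// (lnM (x := g^-1)) ?posrE ?invr_gt0 ?expR_gt0//.
rewrite !expRK lnV ?posrE// => lW.
rewrite mulNr -mulrN lnM ?posrE//.
have -> : ln (- W) = - ln g - g^-1 - W by rewrite -lW addrK.
by field; rewrite gt_eqF.
Qed.

(** Equality would give [1 - ln g = expR (- ln g)], against the strict inequality [1 + x < expR x]
    for [x != 0]. *)
Lemma t_gam_gt g : 1 < g -> g < t_gam g.
Proof.
move=> g1; have g0 : 0 < g by exact: lt_trans g1.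
have [tg tE] := t_gamP g1; rewrite lt_neqAle tg andbT; apply/eqP => gE.
rewrite -gE in tE.
have lg0 : - ln g != 0 by rewrite oppr_eq0 gt_eqF// ln_gt0.
have := expR_gt1Dx lg0; rewrite expRN lnK ?posrE//.
rewrite -(ltr_pM2l g0) mulrDr mulrN tE mulfV ?gt_eqF//; lra.
Qed.

Lemma ln_t_gam_gt0 g : 1 < g -> 0 < ln (t_gam g).
Proof. by move=> g1; rewrite ln_gt0// (lt_trans g1)// t_gam_gt. Qed.

(** Since [t - 1 = g * ln t], the denominator of [c_gam] factors as [(t - g) * ln t]. *)
Lemma c_gamE g : 1 < g -> c_gam g = (ln (t_gam g))^-1.
Proof.
move=> g1; rewrite /c_gam; have := t_gam_gt g1; have := ln_t_gam_gt0 g1.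
have [_] := t_gamP g1; set t := t_gam g; set l := ln t => gl l0 gt.
have -> : t * l + 1 - t = (t - g) * l by rewrite mulrBl gl; ring.
by rewrite invfM mulrA mulfV ?mul1r// gt_eqF// subr_gt0.
Qed.

(** Based on [(1/2 - b)^2 = 1/4 - b (1 - b)]; it turns lower bounds on [e (1 - e)] into the square
    roots of (i) and (iii). *)
Lemma sub_half_le_sqrt (b s : R) : s <= b * (1 - b) ->
  2^-1 - b <= Num.sqrt (4^-1 - s).
Proof.
move=> sb; apply: le_trans (ler_norm _) _; rewrite -sqrtr_sqr ler_wsqrtr//.
have -> : (2^-1 - b) ^+ 2 = 4^-1 - b * (1 - b) by field.
by rewrite lerB.
Qed.

End real_inequalities.

(** * Pointwise affine lower bounds for the divergence integrands *)

Section pointwise_bounds.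
Set Implicit Arguments. Unset Strict Implicit.
Context {R : realType}.
Implicit Types (w p q a b c e D l : R).

Definition kl_term p q : \bar R :=
  if 0 < p then (if 0 < q then (p * ln (p / q))%:E else +oo%E) else 0%E.

Definition chi2_term p q : \bar R :=
  if 0 < q then ((p - q) ^+ 2 / q)%:E else if 0 < p then +oo%E else 0%E.

Variant kl_term_spec p q : \bar R -> Prop :=
| KlTermInfty : kl_term_spec p q +oo%E
| KlTerm0 of p = 0 : kl_term_spec p q 0%E
| KlTermPos of 0 < p & 0 < q : kl_term_spec p q (p * ln (p / q))%:E.

Lemma kl_termP p q : 0 <= p -> kl_term_spec p q (kl_term p q).
Proof.
rewrite /kl_term le_eqVlt => /predU1P[<-|p0].
  by rewrite ltxx; constructor.
by rewrite p0; case: ifPn => // q1; constructor.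
Qed.

(** With [s = min a b / (a + b)], the left side is [(a + b) * s * (1 - s)], bounded by the tangent
    of the concave [s (1 - s)] at [e]. For [a = w p], [b = (1 - w) q] and [e] the Bayes error, the
    right side integrates to [e (1 - e)]. *)
Lemma mul_div_add_le_min a b e : 0 <= a -> 0 <= b -> 0 < a + b ->
  a * b / (a + b) <= Num.min a b * (1 - 2 * e) + e ^+ 2 * (a + b).
Proof.
move=> a0 b0 ab0; set n := Num.min a b.
have -> : a * b = n * (a + b - n) by rewrite /n; case: leP => _; ring.
rewrite -subr_ge0.
have -> : n * (1 - 2 * e) + e ^+ 2 * (a + b) - n * (a + b - n) / (a + b)
    = (n - e * (a + b)) ^+ 2 / (a + b) by field; rewrite gt_eqF.
by rewrite divr_ge0 ?sqr_ge0// ltW.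
Qed.

Lemma mixture_gt0 w p q : 0 < w < 1 -> 0 <= p -> 0 < q ->
  0 < w * p + (1 - w) * q.
Proof.
move=> /andP[w0 w1] p0 q0; rewrite ltr_wpDl ?mulr_ge0 ?mulr_gt0 ?subr_gt0//.
exact: ltW.
Qed.

Lemma kl_term_ge_sub p q : 0 <= p -> 0 <= q -> ((p - q)%:E <= kl_term p q)%E.
Proof.
move=> p0 q0; case: (kl_termP q p0); first by rewrite leey.
- by move=> ->; rewrite lee_fin; lra.
- by move=> p1 q1; rewrite lee_fin mul_ln_ge.
Qed.

(** Split [ln (p / q)] at the mixture [m]: [p ln (p / m) >= p - m], and
    [ln (m / q) >= 1 + D - expR D * q / m]. The factor [k] is chosen so that the term in [p q / m]
    is bounded by [mul_div_add_le_min]. *)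
Lemma kl_term_ge_expR w p q D e (k := expR D / (w * (1 - w))) :
  0 < w < 1 -> 0 <= p -> 0 <= q ->
  (((2 + D - (1 + k * e ^+ 2) * w) * p + - ((1 + k * e ^+ 2) * (1 - w)) * q
   + - (k * (1 - 2 * e)) * Num.min (w * p) ((1 - w) * q))%:E <= kl_term p q)%E.
Proof.
move=> w01; have /andP[w0 w1] := w01; move=> p0 q0.
have v0 : 0 < 1 - w by rewrite subr_gt0.
have k0 : 0 < k by rewrite divr_gt0 ?expR_gt0 ?mulr_gt0.
case: (kl_termP q p0); first by rewrite leey.
  move=> ->; rewrite !mulr0 min_l; last by rewrite mulr_ge0// ltW.
  have ke0 : 0 <= k * e ^+ 2 by rewrite mulr_ge0 ?sqr_ge0 ?ltW.
  rewrite mulr0 add0r addr0 lee_fin mulNr oppr_le0 mulr_ge0//.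
  by rewrite mulr_ge0 ?(ltW v0)// addr_ge0.
move=> p1 q1; rewrite lee_fin.
have := mixture_gt0 w01 p0 q1.
have := @mul_div_add_le_min (w * p) ((1 - w) * q) e.
set m := w * p + (1 - w) * q; set n := Num.min _ _ => H m0.
have {H} /(ler_wpM2l (ltW k0)) H := H (mulr_ge0 (ltW w0) p0)
  (mulr_ge0 (ltW v0) q0) m0.
have kE : k * (w * p * ((1 - w) * q) / m) = p * (expR D * (q / m)).
  by rewrite /k; field; rewrite !gt_eqF.
rewrite {}kE in H.
have qm0 : 0 < q / m by rewrite divr_gt0.
rewrite (ln_div_chain p1 m0 q1) [leRHS]mulrDr.
have pm := mul_ln_ge p1 m0.
have := ln_leB1 (mulr_gt0 (expR_gt0 D) qm0).
rewrite (lnM (x := expR D)) ?posrE ?expR_gt0// expRK => /(ler_wpM2l p0) H2.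
have -> : ln (m / q) = - ln (q / m) by rewrite -lnV ?posrE// invf_div.
have -> : (2 + D - (1 + k * e ^+ 2) * w) * p + - ((1 + k * e ^+ 2) * (1 - w)) * q
   + - (k * (1 - 2 * e)) * n =
   (2 + D) * p - m - k * (n * (1 - 2 * e) + e ^+ 2 * m) by rewrite /m; ring.
rewrite mulrDr mulrBr mulr1 in H2; rewrite mulrN; lra.
Qed.

(** The tangent of [1 / y] at [c], taken at [y = m / q] and weighted by [p], amounts to
    [p (c q - m)^2 / (w m q) >= 0]; the resulting term in [p q / m] is again bounded by
    [mul_div_add_le_min]. *)
Lemma chi2_term_ge w p q c e (k := c ^+ 2 / (w ^+ 2 * (1 - w))) :
  0 < w < 1 -> 0 < c -> 0 <= p -> 0 <= q ->
  (((2 * c / w - k * e ^+ 2 * w - (1 - w) / w - 2) * p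
   + (1 - k * e ^+ 2 * (1 - w)) * q
   + - (k * (1 - 2 * e)) * Num.min (w * p) ((1 - w) * q))%:E
   <= chi2_term p q)%E.
Proof.
move=> w01; have /andP[w0 w1] := w01; move=> c0 p0.
have v0 : 0 < 1 - w by rewrite subr_gt0.
have k0 : 0 < k by rewrite divr_gt0 ?mulr_gt0 ?exprn_gt0.
rewrite /chi2_term le_eqVlt => /predU1P[<-|q0].
  rewrite ltxx; case: ifPn => [_|]; first by rewrite leey.
  rewrite -leNgt => p1; have -> : p = 0 by apply/eqP; rewrite eq_le p1.
  by rewrite !mulr0 minxx !mulr0 !addr0.
rewrite q0 lee_fin; have := mixture_gt0 w01 p0 q0.
have := @mul_div_add_le_min (w * p) ((1 - w) * q) e.
set m := w * p + (1 - w) * q; set n := Num.min _ _ => H m0.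
have {H} /(ler_wpM2l (ltW k0)) H := H (mulr_ge0 (ltW w0) p0)
  (mulr_ge0 (ltW v0) (ltW q0)) m0.
have kE : k * (w * p * ((1 - w) * q) / m) = c ^+ 2 * p * q / (w * m).
  by rewrite /k; field; rewrite !gt_eqF.
rewrite {}kE in H.
have sq : 0 <= p * (c * q - m) ^+ 2 / (w * m * q).
  by rewrite divr_ge0 ?(mulr_ge0 p0 (sqr_ge0 _))// ltW// !mulr_gt0.
have sqE : p * (c * q - m) ^+ 2 / (w * m * q) =
    (p - q) ^+ 2 / q - (2 * c / w - (1 - w) / w - 2) * p - q
    + c ^+ 2 * p * q / (w * m).
  have mE : m = w * p + (1 - w) * q by [].
  have -> : (p - q) ^+ 2 / q = (p * m / q - (1 - w) * p) / w - 2 * p + q.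
    by rewrite mE; field; rewrite !gt_eqF.
  by field; rewrite !gt_eqF.
have -> : (2 * c / w - k * e ^+ 2 * w - (1 - w) / w - 2) * p
   + (1 - k * e ^+ 2 * (1 - w)) * q + - (k * (1 - 2 * e)) * n =
   (2 * c / w - (1 - w) / w - 2) * p + q - k * (n * (1 - 2 * e) + e ^+ 2 * m).
  by rewrite /m; ring.
by rewrite sqE in sq; lra.
Qed.

(** The left side is the tangent at [p / q = 1] or at [p / q = t_gam], according to which argument
    attains the minimum. The equation of [t_gam] makes the two lines meet at [p / q = (1 - w) / w],
    the kink of the minimum. *)
Lemma kl_term_ge_t_gam w p q (l := ln (t_gam ((1 - w) / w))) :
  0 < w < 2^-1 -> 0 <= p -> 0 <= q ->
  (((l + 1) * p + -1 * q + - (l / w) * Num.min (w * p) ((1 - w) * q))%:E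
   <= kl_term p q)%E.
Proof.
move=> /andP[w0 w12] p0 q0.
have v0 : 0 < 1 - w by lra.
have g1 : 1 < (1 - w) / w by rewrite ltr_pdivlMr//; lra.
have l0 : 0 < l by exact: ln_t_gam_gt0.
have [tg tE] := t_gamP g1; rewrite -/l in tE.
have t0 : 0 < t_gam ((1 - w) / w) by rewrite (lt_le_trans _ tg)// divr_gt0.
case: (kl_termP q p0); first by rewrite leey.
  move=> ->; rewrite !mulr0 min_l; last by rewrite mulr_ge0// ltW.
  by rewrite mulr0 add0r addr0 lee_fin; lra.
move=> p1 q1; rewrite lee_fin; have [_|_] := leP (w * p) ((1 - w) * q).
  have -> : (l + 1) * p + -1 * q + - (l / w) * (w * p) = p - q.
    by field; rewrite gt_eqF.
  exact: mul_ln_ge.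
have := mul_ln_ge p1 (mulr_gt0 t0 q1).
set t := t_gam _ in t0 tE *; have -> : p / (t * q) = p / q / t.
  by field; rewrite !gt_eqF.
rewrite (ln_div (x := p / q)) ?posrE ?divr_gt0// -/l.
have -> : - (l / w) * ((1 - w) * q) = - ((1 - w) / w * l) * q by ring.
by rewrite tE; lra.
Qed.

(** Here [|p - q| = p + q - 4 n] with [n] the minimum. With [A = 2 p + 4 q], the term
    [3 |p - q|^2 / A] is linearised as [2 l |p - q| - l^2 A / 3] by completing a square. *)
Lemma kl_term_ge_pinsker p q l : 0 <= p -> 0 <= q ->
  (((1 + 2 * l - 2 / 3 * l ^+ 2) * p + (2 * l - 1 - 4 / 3 * l ^+ 2) * q
   + - (8 * l) * Num.min (2^-1 * p) ((1 - 2^-1) * q))%:E <= kl_term p q)%E.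
Proof.
move=> p0 q0; case: (kl_termP q p0); first by rewrite leey.
  move=> ->; rewrite !mulr0 min_l; last by rewrite mulr_ge0//; lra.
  by rewrite mulr0 add0r addr0 lee_fin mulr_le0_ge0//; have := sqr_ge0 (l - 3 / 4); nra.
move=> p1 q1; rewrite lee_fin; apply: le_trans (mul_ln_ge_sqr p1 q1).
set n := Num.min _ _.
have -> : 3 * (p - q) ^+ 2 / (2 * p + 4 * q)
    = 3 * (p + q - 4 * n) ^+ 2 / (2 * p + 4 * q).
  by congr (_ / _); rewrite /n; case: leP => _; field.
rewrite -subr_ge0.
have A0 : 0 < 2 * p + 4 * q by lra.
rewrite (_ : _ - _ = 3 * (p + q - 4 * n - l * (2 * p + 4 * q) / 3) ^+ 2 / (2 * p + 4 * q)).
  by rewrite divr_ge0 ?(mulr_ge0 _ (sqr_ge0 _))// ltW.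
by field; rewrite gt_eqF.
Qed.

End pointwise_bounds.

(** * Measurability and integration *)

Section divergences.
Set Implicit Arguments. Unset Strict Implicit.
Context {d : measure_display} {T : measurableType d} {R : realType}.
Context (mu : {measure set T -> \bar R}).
Implicit Types (p q : T -> R) (w : R).

(* No integrability is needed: the convention [+oo - +oo = -oo] keeps subtraction
   monotone. *)
Lemma le_integral_measurable (f g : T -> \bar R) :
  measurable_fun setT f -> measurable_fun setT g -> (forall x, f x <= g x)%E ->
  (\int[mu]_x f x <= \int[mu]_x g x)%E.
Proof.
move=> mf mg fg; rewrite integralE [leRHS]integralE leeB//.
- apply: ge0_le_integral => //; [exact: measurable_funepos..|].
  by move=> x /mem_set; apply: funepos_le.
- apply: ge0_le_integral => //; [exact: measurable_funeneg..|].
  by move=> x /mem_set; apply: funeneg_le.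
Qed.

Lemma measurable_kl_term p q : measurable_fun setT p -> measurable_fun setT q ->
  measurable_fun setT (fun x => kl_term (p x) (q x)).
Proof.
move=> mp mq.
have -> : (fun x => kl_term (p x) (q x)) = (fun x => if 0 < p x then
    (if 0 < q x then (p x * (ln (p x) - ln (q x)))%:E else +oo%E) else 0%E).
  apply/funext => x; rewrite /kl_term.
  by case: ifPn => // p0; case: ifPn => // q0; rewrite ln_div.
apply: measurable_fun_ifT => //; first exact: measurable_fun_ltr.
apply: measurable_fun_ifT => //; first exact: measurable_fun_ltr.
apply/measurable_EFinP/measurable_funM => //.
by apply: measurable_funB; exact: measurableT_comp (@measurable_ln R) _.
Qed.

Lemma measurable_chi2_term p q : measurable_fun setT p -> measurable_fun setT q ->
  measurable_fun setT (fun x => chi2_term (p x) (q x)).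
Proof.
move=> mp mq.
(* The quotient is written as a power of exponent [-1], a measurable function. *)
have -> : (fun x => chi2_term (p x) (q x)) = (fun x => if 0 < q x then
    ((p x - q x) ^+ 2 * (q x) `^ (-1))%:E else if 0 < p x then +oo%E else 0%E).
  apply/funext => x; rewrite /chi2_term.
  by case: ifPn => // q0; rewrite powR_inv1 // ltW.
apply: measurable_fun_ifT => //; first exact: measurable_fun_ltr.
  apply/measurable_EFinP/measurable_funM => //.
    by apply: measurable_funX; exact: measurable_funB.
  exact: measurableT_comp (@measurable_powR R (-1)) _.
by apply: measurable_fun_ifT => //; exact: measurable_fun_ltr.
Qed.

Lemma integrable_density p : is_density mu p -> mu.-integrable setT (EFin \o p).
Proof.
move=> [mp p0 p1]; apply/integrableP; split; first exact/measurable_EFinP.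
under eq_integral => x _ do rewrite /= ger0_norm//.
by rewrite p1 ltry.
Qed.

Definition bayes_error w p q : R :=
  fine (\int[mu]_x (Num.min (w * p x) ((1 - w) * q x))%:E).

Lemma bayes_errorC w p q : bayes_error w p q = bayes_error (1 - w) q p.
Proof.
rewrite /bayes_error; congr fine; apply: eq_integral => x _.
by rewrite minC subKr.
Qed.

(** * The Bayes error of two densities *)

Section two_densities.
Context {p q : T -> R} {w : R}.
Context (pd : is_density mu p) (qd : is_density mu q) (w01 : 0 < w < 1).

Let p0 x : 0 <= p x. Proof. by case: pd. Qed.
Let q0 x : 0 <= q x. Proof. by case: qd. Qed.
Let mp : measurable_fun setT p. Proof. by case: pd. Qed.
Let mq : measurable_fun setT q. Proof. by case: qd. Qed.

Let min_ge0 x : 0 <= Num.min (w * p x) ((1 - w) * q x).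
Proof.
by case/andP: w01 => w0 w1; rewrite le_min !mulr_ge0// ?subr_ge0 ltW.
Qed.

Let measurable_min :
  measurable_fun setT (fun x => Num.min (w * p x) ((1 - w) * q x)).
Proof.
by apply: measurable_minr; apply: measurable_funM => //; exact: measurable_cst.
Qed.

Let integrable_min :
  mu.-integrable setT (fun x => (Num.min (w * p x) ((1 - w) * q x))%:E).
Proof.
have ip := integrableZl measurableT w (integrable_density pd).
apply: le_integrable ip => //; first exact/measurable_EFinP.
move=> x _ /=; rewrite lee_fin !ger0_norm ?ge_min ?lexx//.
by case/andP: w01 => w0 _; rewrite mulr_ge0// ltW.
Qed.

Lemma bayes_errorE :
  (\int[mu]_x (Num.min (w * p x) ((1 - w) * q x))%:E = (bayes_error w p q)%:E)%E.
Proof. by rewrite /bayes_error fineK// integrable_fin_num. Qed.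

Lemma bayes_error_ge0 : 0 <= bayes_error w p q.
Proof. by apply: fine_ge0; apply: integral_ge0 => x _; rewrite lee_fin. Qed.

Lemma integral_affine (a b c : R) :
  (\int[mu]_x (a * p x + b * q x + c * Num.min (w * p x) ((1 - w) * q x))%:E
   = (a + b + c * bayes_error w p q)%:E)%E.
Proof.
have ip := integrableZl measurableT a (integrable_density pd).
have iq := integrableZl measurableT b (integrable_density qd).
have im := integrableZl measurableT c integrable_min.
have [[_ _ p1] [_ _ q1]] := (pd, qd).
under eq_integral do rewrite !EFinD !EFinM.
rewrite (integralD measurableT (integrableD measurableT ip iq) im).
rewrite (integralD measurableT ip iq).
rewrite (integralZl measurableT (integrable_density pd)).
rewrite (integralZl measurableT (integrable_density qd)).
rewrite (integralZl measurableT integrable_min).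
by rewrite bayes_errorE /= p1 q1 !mule1.
Qed.

Lemma affine_le_integral (f : T -> \bar R) (a b c : R) :
  measurable_fun setT f ->
  (forall x, ((a * p x + b * q x + c * Num.min (w * p x) ((1 - w) * q x))%:E
    <= f x)%E) ->
  ((a + b + c * bayes_error w p q)%:E <= \int[mu]_x f x)%E.
Proof.
move=> mf h; rewrite -integral_affine; apply: le_integral_measurable => //.
apply/measurable_EFinP; apply: measurable_funD.
  by apply: measurable_funD; apply: measurable_funM => //; exact: measurable_cst.
by apply: measurable_funM => //; exact: measurable_cst.
Qed.

Lemma affine_le_KL (a b c : R) :
  (forall x, ((a * p x + b * q x + c * Num.min (w * p x) ((1 - w) * q x))%:E
    <= kl_term (p x) (q x))%E) ->
  ((a + b + c * bayes_error w p q)%:E <= KL mu p q)%E.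
Proof. exact/affine_le_integral/measurable_kl_term. Qed.

Lemma affine_le_chi2 (a b c : R) :
  (forall x, ((a * p x + b * q x + c * Num.min (w * p x) ((1 - w) * q x))%:E
    <= chi2_term (p x) (q x))%E) ->
  ((a + b + c * bayes_error w p q)%:E <= chi2 mu p q)%E.
Proof. exact/affine_le_integral/measurable_chi2_term. Qed.

Lemma KL_ge0 : (0 <= KL mu p q)%E.
Proof.
have -> : 0%E = (1 + -1 + 0 * bayes_error w p q)%:E :> \bar R.
  by rewrite mul0r addr0 subrr.
apply: affine_le_KL => x; rewrite mul1r mulN1r mul0r addr0.
exact: kl_term_ge_sub.
Qed.

Lemma chi2_ge0 : (0 <= chi2 mu p q)%E.
Proof.
apply: integral_ge0 => x _; case: ifPn => q1; last by case: ifP.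
by rewrite lee_fin divr_ge0 ?sqr_ge0.
Qed.

(** Where [q > 0], the integrand is [min w (1 - w) * q - min (w p) ((1 - w) q)]; where [q = 0], this
    expression vanishes, in agreement with the convention in the definition. *)
Lemma degroot_infoE :
  degroot_info mu w p q = (Num.min w (1 - w) - bayes_error w p q)%:E.
Proof.
have /andP[w0 w1] := w01.
have := integral_affine 0 (Num.min w (1 - w)) (-1).
rewrite add0r mulN1r => <-; apply: eq_integral => x _.
rewrite mul0r add0r mulN1r; case: ifPn => [q1|].
  rewrite /phi_deg mulrBr mulrC; congr (_ - _)%:E.
  rewrite minr_pMr ?ltW//; congr Num.min; last exact: mulrC.
  by field; rewrite gt_eqF.
rewrite lt0r q0 andbT negbK => /eqP ->; rewrite !mulr0 min_r ?subrr//.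
by rewrite mulr_ge0// ltW.
Qed.

(** * Bounds on the Bayes error by the divergences *)

Lemma bayes_error_mul_ge_KL (D : R) : KL mu p q = D%:E ->
  w * (1 - w) * expR (- D) <= bayes_error w p q * (1 - bayes_error w p q).
Proof.
have /andP[w0 w1] := w01; set e := bayes_error w p q => DE.
have k0 : 0 < w * (1 - w) by rewrite mulr_gt0 ?subr_gt0.
(* With both parameters at their actual values, integration gives [1 + D - k e (1 - e) <= D]. *)
have := affine_le_KL (fun x => kl_term_ge_expR D e w01 (p0 x) (q0 x)).
rewrite DE lee_fin -/e expRN; set k := expR D / _ => h.
have -> : e * (1 - e) = w * (1 - w) / expR D * (k * (e * (1 - e))).
  by rewrite /k; field; rewrite !gt_eqF ?expR_gt0 ?subr_gt0.
have h1 : 1 <= k * (e * (1 - e)) by lra.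
by rewrite ler_peMr// divr_ge0 ?expR_ge0// ltW.
Qed.

Lemma bayes_error_mul_ge_chi2 (c : R) : chi2 mu p q = c%:E ->
  w * (1 - w) / (1 + w * c) <= bayes_error w p q * (1 - bayes_error w p q).
Proof.
have /andP[w0 w1] := w01; set e := bayes_error w p q => cE.
have c0 : 0 <= c by have := chi2_ge0; rewrite cE lee_fin.
have C0 : 0 < 1 + w * c by rewrite ltr_wpDr// mulr_ge0// ltW.
have k0 : 0 < w * (1 - w) by rewrite mulr_gt0 ?subr_gt0.
(* The tangent point [C = 1 + w c] is the mean of [m / q] under [P]; integration gives
   [C <= k w e (1 - e)]. *)
have := affine_le_chi2 (fun x => chi2_term_ge e w01 C0 (p0 x) (q0 x)).
rewrite cE lee_fin -/e; set C := 1 + w * c in C0 *; set k := C ^+ 2 / _ => h.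
have v0 : 0 < 1 - w by rewrite subr_gt0.
have {}h : 0 <= k * w * (e * (1 - e)) - C.
  have cC : c = (C - 1) / w by rewrite /C; field; rewrite gt_eqF.
  have : 0 <= w * (c - (2 * C / w - k * e ^+ 2 * w - (1 - w) / w - 2 +
    (1 - k * e ^+ 2 * (1 - w)) + - (k * (1 - 2 * e)) * e)).
    by rewrite mulr_ge0 ?subr_ge0// ltW.
  congr (0 <= _); rewrite {1}cC; by field; rewrite gt_eqF.
rewrite ler_pdivrMr//.
have -> : e * (1 - e) * C = w * (1 - w) / C * (k * w * (e * (1 - e))).
  by rewrite /k; field; rewrite !gt_eqF.
by rewrite -[leLHS](divfK (lt0r_neq0 C0)) ler_pM2l ?divr_gt0// -subr_ge0.
Qed.

(** Serves the case of an infinite divergence. *)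
Lemma sub_bayes_error_le_half : 2^-1 - bayes_error w p q <= Num.sqrt 4^-1.
Proof.
have -> : (4^-1 : R) = 4^-1 - 0 by rewrite subr0.
apply: le_trans (sub_half_le_sqrt (b := 0) _); last by rewrite mul0r.
by rewrite lerB// bayes_error_ge0.
Qed.

Lemma bayes_error_bound_KL (a : R) :
  ((a + (2^-1 - bayes_error w p q))%:E <=
   ext_bound (fun D => a + Num.sqrt (4^-1 - w * (1 - w) * expR (- D)))%R
     (a + Num.sqrt 4^-1)%:E (KL mu p q))%E.
Proof.
case DE : (KL mu p q) => [D| |] /=; rewrite lee_fin lerD2l.
- exact/sub_half_le_sqrt/bayes_error_mul_ge_KL.
- exact: sub_bayes_error_le_half.
- exact: sub_bayes_error_le_half.
Qed.

Lemma bayes_error_bound_chi2 (a u : R) : w <= u ->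
  ((a + (2^-1 - bayes_error w p q))%:E <=
   ext_bound (fun c => a + Num.sqrt (4^-1 - w * (1 - w) / (1 + u * c)))%R
     (a + Num.sqrt 4^-1)%:E (chi2 mu p q))%E.
Proof.
have /andP[w0 w1] := w01 => wu.
case cE : (chi2 mu p q) => [c| |] /=; rewrite lee_fin lerD2l.
- have c0 : 0 <= c by have := chi2_ge0; rewrite cE lee_fin.
  apply: sub_half_le_sqrt; apply: le_trans (bayes_error_mul_ge_chi2 cE).
  have C0 : 0 < 1 + w * c by rewrite ltr_wpDr// mulr_ge0// ltW.
  have uc : 1 + w * c <= 1 + u * c by rewrite lerD2l ler_wpM2r.
  rewrite ler_wpM2l ?mulr_ge0 ?subr_ge0 ?(ltW w0) ?(ltW w1)//.
  by rewrite lef_pV2 ?posrE// (lt_le_trans C0).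
- exact: sub_bayes_error_le_half.
- exact: sub_bayes_error_le_half.
Qed.

Lemma bayes_error_bound_c_gam : w < 2^-1 ->
  ((w - bayes_error w p q)%:E <= (w * c_gam ((1 - w) / w))%:E * KL mu p q)%E.
Proof.
have /andP[w0 _] := w01 => w12.
have w012 : 0 < w < 2^-1 by rewrite w0.
have g1 : 1 < (1 - w) / w by rewrite ltr_pdivlMr//; lra.
have := affine_le_KL (fun x => kl_term_ge_t_gam w012 (p0 x) (q0 x)).
rewrite c_gamE//; have := ln_t_gam_gt0 g1; set l := ln _ => l0 h.
have wl0 : 0 < w / l by rewrite divr_gt0.
(* The integrated bound reads [(l / w) (w - e) <= D], and [w / l] is the stated factor. *)
have -> : (w - bayes_error w p q)%:E =
    ((w / l)%:E * (l + 1 + -1 + - (l / w) * bayes_error w p q)%:E)%E.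
  by rewrite -EFinM; congr EFin; field; rewrite !gt_eqF.
by rewrite lee_wpmul2l// lee_fin ltW.
Qed.

End two_densities.

Lemma bayes_error_pinsker p q : is_density mu p -> is_density mu q ->
  ((2^-1 - bayes_error 2^-1 p q)%:E <=
   ext_bound (fun D => Num.sqrt (8^-1 * D))%R +oo (KL mu p q))%E.
Proof.
move=> pd qd; have h01 : 0 < (2^-1 : R) < 1 by apply/andP; split; lra.
have := KL_ge0 pd qd h01.
case DE : (KL mu p q) => [D| |] //= _; last by rewrite leey.
(* The integrated bound [4 l (1 - 2 e) - 2 l^2 <= D] is strongest at this [l], where it reads
   [2 l^2 <= D]. *)
set e := bayes_error _ _ _; pose l := 1 - 2 * e.
have [_ p0 _] := pd; have [_ q0 _] := qd.
have := affine_le_KL pd qd h01 (fun x => kl_term_ge_pinsker l (p0 x) (q0 x)).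
rewrite DE !lee_fin -/e => h.
apply: le_trans (ler_norm _) _; rewrite -sqrtr_sqr ler_wsqrtr//.
have -> : 2^-1 - e = l / 2 by rewrite /l; field.
have eE : e = (1 - l) / 2 by rewrite /l; field.
by rewrite eE in h; lra.
Qed.

End divergences.

(** * Assembly of the seven bounds *)

Theorem theorem7 (R : realType) (d : measure_display) (T : measurableType d)
  (mu : {measure set T -> \bar R}) (p q : T -> R) (w : R) :
  is_density mu p -> is_density mu q -> 0 < w < 1 ->
  (* (i) *)
  (w <= 2^-1 ->
     (degroot_info mu w p q <=
      ext_bound (fun c => w - 2^-1 + Num.sqrt (4^-1 - w * (1 - w) / (1 + w * c)))%R
                (w - 2^-1 + Num.sqrt 4^-1)%:E (chi2 mu p q))%E) /\
  (2^-1 < w ->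
     (degroot_info mu w p q <=
      ext_bound (fun c => 2^-1 - w + Num.sqrt (4^-1 - w * (1 - w) / (1 + w * c)))%R
                (2^-1 - w + Num.sqrt 4^-1)%:E (chi2 mu q p))%E) /\
  (* (ii) *)
  (w < 2^-1 ->
     (degroot_info mu w p q <= (w * c_gam ((1 - w) / w))%:E * KL mu p q)%E) /\
  (w = 2^-1 ->
     (degroot_info mu w p q <=
      ext_bound (fun D => Num.sqrt (8^-1 * D))%R +oo%E
                (Order.min (KL mu p q) (KL mu q p)))%E) /\
  (2^-1 < w ->
     (degroot_info mu w p q <= ((1 - w) * c_gam (w / (1 - w)))%:E * KL mu q p)%E) /\
  (* (iii) *)
  (w <= 2^-1 ->
     (degroot_info mu w p q <=
      ext_bound (fun D => w - 2^-1 + Num.sqrt (4^-1 - w * (1 - w) * expR (- D)))%R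
                (w - 2^-1 + Num.sqrt 4^-1)%:E (KL mu p q))%E) /\
  (2^-1 < w ->
     (degroot_info mu w p q <=
      ext_bound (fun D => 2^-1 - w + Num.sqrt (4^-1 - w * (1 - w) * expR (- D)))%R
                (2^-1 - w + Num.sqrt 4^-1)%:E (KL mu q p))%E).
Proof.
move=> pd qd w01.
have v01 : 0 < 1 - w < 1 by case/andP: w01 => w0 w1; apply/andP; split; lra.
have vvE : (1 - w) * (1 - (1 - w)) = w * (1 - w) by rewrite subKr mulrC.
set e := bayes_error mu w p q.
have eE : bayes_error mu (1 - w) q p = e by rewrite -bayes_errorC.
have IE : degroot_info mu w p q = (Num.min w (1 - w) - e)%:E.
  exact: degroot_infoE.
have IEle : w <= 2^-1 -> degroot_info mu w p q = (w - e)%:E.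
  by move=> w12; rewrite IE min_l//; lra.
have IEgt : 2^-1 < w -> degroot_info mu w p q = (1 - w - e)%:E.
  by move=> w12; rewrite IE min_r//; lra.
have lowE : w - e = w - 2^-1 + (2^-1 - e) by ring.
have highE : 1 - w - e = 2^-1 - w + (2^-1 - e) by field.
split; last split; last split; last split; last split; last split; move=> w12.
- rewrite IEle// lowE; exact: bayes_error_bound_chi2.
- rewrite IEgt// highE -vvE -eE; apply: bayes_error_bound_chi2 => //; lra.
- rewrite IEle ?(ltW w12)//; exact: bayes_error_bound_c_gam.
- rewrite IEle; last by rewrite w12.
  rewrite /e w12 minElt; case: ifP => _; first exact: bayes_error_pinsker.
  (* At weight [1/2] the Bayes error is symmetric in [p] and [q], so either divergence may be the
     minimum. *)
  rewrite bayes_errorC; have -> : 1 - 2^-1 = 2^-1 :> R by field.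
  exact: bayes_error_pinsker.
- rewrite IEgt//.
  have := bayes_error_bound_c_gam qd pd v01; rewrite subKr eE; apply; lra.
- rewrite IEle// lowE; exact: bayes_error_bound_KL.
- rewrite IEgt// highE -vvE -eE; exact: bayes_error_bound_KL.
Qed.
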